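(* Let $([n],\varepsilon_t)$, $t\in\mathbb Z$, be a stationary sequence of (non-independent) random graphs, and consider an information spreading protocol whose completion time on a sequence of independent graphs distributed as the stationary marginal of $(\varepsilon_t)$ is $O(r(n))$ with high probability. Suppose there is an almost surely finite coupling from the past algorithm for $(\varepsilon_t)$, and let $t_1=0>t_2>t_3>\cdots$ be the associated sequence of times obtained by iterating it (so that the graphs $([n],\varepsilon_{t_i})$ are independent and each distributed according to the stationary marginal). If, for sufficiently large constants $C,D$ and some $\lambda>0$, \[\mathbb P\big(-t_{Cr(n)}>Dr(n)\big)\le \frac1{n^\lambda},\] then the completion time of the protocol over $([n],\varepsilon_t)$ is $O(r(n))$ with high probability.
   Context: Coupling from the past (CFTP): the process $(\varepsilon_t)$ with values in a finite alphabet $A$ (here $A=\{0,1\}^{E}$, $E$ the set of possible edges) is generated by an update function $f:A^{-\mathbb N}\times[0,1]\to A$ via $\varepsilon_{t+1}=f(U_{t+1},\varepsilon_t,\varepsilon_{t-1},\dots)$ with $(U_t)_{t\in\mathbb Z}$ i.i.d. uniform on $[0,1]$, where $\mathbb P(f(U,\hat a)=a)$ equals the transition kernel $P(a\mid\hat a)$. Iterating gives $f_{i,k}(\hat a,U_i,\dots,U_k)$, the value at time $k$ from past $\hat a$ using $U_i,\dots,U_k$. The coalescing time is $\theta_k=\max\{i\le k: f_{i,k}(\hat a,U_i,\dots,U_k)\text{ does not depend on }\hat a\}$; the CFTP is almost surely finite if $\theta_0>-\infty$ a.s. The times are defined by $\tau_1=\theta_0$, $\tau_{j+1}=\theta_{\tau_j-1}$,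 and $t_1=0$, $t_{j+1}=\tau_j-1$. A protocol starts with a single informed vertex and spreads information in synchronous rounds along edges of the current graph; the completion time is the number of rounds until all vertices are informed. ''$O(r(n))$ with high probability'' means there are constants $C',c>0$ with $\mathbb P(\text{completion time}>C'r(n))\le n^{-c}$ for large $n$.
   Formalization: The protocol is taken to use the same memoryless rule every round, with random choices i.i.d. over rounds and independent of the graphs, and to be monotone in the informed set (flooding, push, pull); without this the claim fails. Coalescence events are assumed measurable. *)

(* Defs.v *)
From HB Require Import structures.
From mathcomp Require Import all_boot all_order all_algebra.
From mathcomp Require Import all_classical all_reals all_analysis.

Set Implicit Arguments.
Unset Strict Implicit.
Unset Printing Implicit Defensive.

Import Order.TTheory GRing.Theory Num.Theory.
Import numFieldNormedType.Exports.

Local Open Scope classical_set_scope.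
Local Open Scope ring_scope.

Definition edge (n : nat) := {e : {set 'I_n} | #|e| == 2%N}.

(* A simple graph on [n] is a point of {0,1}^E, with E the set of all
   unordered pairs of vertices. *)
Definition sgraph (n : nat) := {ffun edge n -> bool}.

Definition adj (n : nat) (G : sgraph n) (u v : 'I_n) : Prop :=
  exists2 e : edge n, val e = [set u; v]%SET & G e.

Definition mutually_independent (R : realType) (d : measure_display)
    (T : measurableType d) (P : probability T R) (I : eqType)
    (F : I -> set_system T) : Prop :=
  forall (s : seq I) (E : I -> set T), uniq s ->
    (forall i, i \in s -> F i (E i)) ->
    P (\bigcap_(i in [set` s]) E i) = (\prod_(i <- s) P (E i))%E.

(* Finite alphabets carry the discrete sigma-algebra, so that the
   sigma-algebra generated by X consists of all sets X^-1(B). *)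
Definition sigma_discrete (T A : Type) (X : T -> A) : set_system T :=
  preimage_set_system setT X setT.

Definition discrete_rv (d : measure_display) (T : measurableType d) (A : Type)
    (X : T -> A) : Prop :=
  forall B : set A, measurable (X @^-1` B).

Definition stationary (R : realType) (d : measure_display)
    (T : measurableType d) (P : probability T R) (A : Type)
    (eps : int -> T -> A) : Prop :=
  forall (s : seq int) (g : int -> A) (h : int),
    P [set w | forall t, t \in s -> eps (t + h) w = g t] =
    P [set w | forall t, t \in s -> eps t w = g t].

Section coupling_from_the_past.
Variables (R : realType) (A : finType).

(* A past (a_0, a_{-1}, a_{-2}, ...) is stored as the function j |-> a_{-j}. *)
Definition past := nat -> A.

Definition push_past (b : A) (a : past) : past :=
  fun j => if j is j'.+1 then a j' else b.

Variable f : R -> past -> A.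

(* [run_past u i a m] is the past seen from time i + m - 1 when the past a is
   placed just before time i and the updates use u_i, ..., u_{i+m-1}. *)
Fixpoint run_past (u : int -> R) (i : int) (a : past) (m : nat) : past :=
  if m is m'.+1 then
    let b := run_past u i a m' in push_past (f (u (i + m'%:Z)) b) b
  else a.

(* f_{i,k}(a, u_i, ..., u_k), meaningful for i <= k *)
Definition iter_update (i k : int) (a : past) (u : int -> R) : A :=
  run_past u i a (absz (k - i + 1)) 0%N.

Definition coalesced (u : int -> R) (i k : int) : Prop :=
  i <= k /\ forall a b : past, iter_update i k a u = iter_update i k b u.

Definition is_coalescing_time (u : int -> R) (k i : int) : Prop :=
  coalesced u i k /\ forall j : int, coalesced u j k -> j <= i.

(* theta_k, with None for -oo *)
Definition theta (u : int -> R) (k : int) : option int :=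
  match pselect (exists i, is_coalescing_time u k i) with
  | left h => Some (projT1 (cid h))
  | right _ => None
  end.

(* [tau u j] is tau_{j+1}: the sequence tau_1, tau_2, ... is indexed from 0. *)
Fixpoint tau (u : int -> R) (j : nat) : option int :=
  if j is j'.+1 then obind (fun s => theta u (s - 1)) (tau u j')
  else theta u 0.

(* [cftp_time u j] is t_j for j >= 1; the value at j = 0 is irrelevant. *)
Definition cftp_time (u : int -> R) (j : nat) : option int :=
  if j is j'.+2 then omap (fun s => s - 1) (tau u j') else Some 0.

(* -t_j, equal to +oo when t_j = -oo *)
Definition cftp_depth (u : int -> R) (j : nat) : \bar R :=
  if cftp_time u j is Some t then (- t%:~R)%:E else +oo%E.

(* [p a b] is the transition probability P(b | a).  The update function is
   given on the whole line, but its values outside [0,1] are only used on a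
   null event.  The field
   [cftp_stopping] is the measurability needed to speak of the law of theta_k:
   the event {theta_k >= i} is determined, as a measurable event, by
   U_i, ..., U_k.  It is not automatic, since coalescence quantifies over
   uncountably many pasts. *)
Record finite_cftp (d : measure_display) (T : measurableType d)
    (P : probability T R) (p : past -> A -> R) (U : int -> {RV P >-> R})
    (eps : int -> T -> A) : Prop := FiniteCFTP {
  cftp_update_measurable : forall (a : past) (b : A),
    measurable [set v : R | f v a = b];
  cftp_update_kernel : forall (t : int) (a : past) (b : A),
    P [set w | f (U t w) a = b] = (p a b)%:E;
  cftp_uniform : forall (t : int) (B : set R), measurable B ->
    distribution P (U t) B = uniform_prob (@ltr01 R) B;
  cftp_independent :
    mutually_independent P (fun t => g_sigma_algebra_preimage (U t));
  cftp_generated : {ae P, forall w, forall t : int,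
    eps (t + 1) w = f (U (t + 1) w) (fun j : nat => eps (t - j%:Z) w)};
  cftp_stopping : forall i k : int, i <= k ->
    <<s \bigcup_(j in [set j : int | i <= j <= k])
          g_sigma_algebra_preimage (U j) >>
      [set w | coalesced (fun t => U t w) i k];
  cftp_finite : {ae P, forall w, theta (fun t => U t w) 0 <> None} }.

End coupling_from_the_past.

(* One round of a protocol maps the current graph, the random choices made in
   that round, and the set of informed vertices to the new set of informed
   vertices.  Informed vertices stay informed, information travels along edges
   of the current graph, and for fixed choices informing more vertices
   beforehand never hurts (flooding, push, pull, push-pull, ...).  The start
   is unconstrained only for the empty vertex set, which has no vertex. *)
Record protocol (n : nat) (d : measure_display) (X : measurableType d) :=
  Protocol {
  start : {set 'I_n};
  round : sgraph n -> X -> {set 'I_n} -> {set 'I_n};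
  start_single : (0 < n)%N -> #|start| = 1%N;
  round_measurable : forall (G : sgraph n) (I J : {set 'I_n}),
    measurable [set x | round G x I = J];
  round_keeps : forall (G : sgraph n) (x : X) (I : {set 'I_n}),
    I \subset round G x I;
  round_along_edges : forall (G : sgraph n) (x : X) (I : {set 'I_n}) (v : 'I_n),
    v \in round G x I -> v \notin I -> exists2 u, u \in I & adj G u v;
  round_monotone : forall (G : sgraph n) (x : X) (I J : {set 'I_n}),
    I \subset J -> round G x I \subset round G x J }.

Fixpoint informed (n : nat) (d : measure_display) (X : measurableType d)
    (pr : protocol n X) (G : nat -> sgraph n) (x : nat -> X) (k : nat) :
    {set 'I_n} :=
  if k is k'.+1 then round pr (G k') (x k') (informed pr G x k')
  else start pr.

Definition completion_time (R : realType) (n : nat) (d : measure_display)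
    (X : measurableType d) (pr : protocol n X) (G : nat -> sgraph n)
    (x : nat -> X) : \bar R :=
  ereal_inf [set (k%:R : R)%:E | k in [set k | informed pr G x k = [set: 'I_n]%SET]].

(* The choices of the successive rounds are i.i.d. with law Q, and independent
   of the whole sequence of graphs (index [None]). *)
Definition protocol_choices (R : realType) (n : nat)
    (d : measure_display) (T : measurableType d) (P : probability T R)
    (dX : measure_display) (X : measurableType dX) (Q : probability X R)
    (G : nat -> T -> sgraph n) (x : nat -> {RV P >-> X}) : Prop :=
  (forall (k : nat) (B : set X), measurable B -> distribution P (x k) B = Q B) /\
  mutually_independent P (fun o : option nat =>
    if o is Some k then g_sigma_algebra_preimage (x k)
    else <<s \bigcup_k sigma_discrete (G k) >>).

Definition bigO_whp (R : realType) (d : nat -> measure_display)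
    (T : forall n, measurableType (d n)) (P : forall n, probability (T n) R)
    (Z : forall n, T n -> \bar R) (r : nat -> R) : Prop :=
  exists C c : R, [/\ 0 < C, 0 < c &
    \forall n \near \oo,
      (P n [set w | (C * r n)%:E < Z n w] <= (n%:R `^ (- c))%:E)%E].

(* Main.v *)
(** Conditionally on the graphs, the probability [failure g K] that the protocol
    is still incomplete after [K] rounds depends only on the law [Q] of the
    choices and on the graphs [g 0, ..., g (K - 1)]; by monotonicity of the
    rounds and exchangeability of the choices it can only increase when the
    sequence of graphs is replaced by a subsequence.  By stationarity the rounds
    [0, ..., L] may be run on the graphs at times [-L, ..., 0].  When
    [t_(N+1) >= -L], these contain the graphs at times [t_N < ... < t_1], and the
    corresponding couplings from the past use disjoint blocks of the [U_t], so
    the probability that these graphs take given values, all couplings being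
    finite, is at most the product of the stationary marginals.  Hence
    incompletion after [L + 1] rounds has probability at most that of
    [t_(N+1) < -L] plus that of incompletion after [N] rounds on independent
    graphs.  The roundings are absorbed in the constants, because a completion
    takes at least one round, so that [r n] is bounded away from [0]. *)

Require Import Defs.
From HB Require Import structures.
From mathcomp Require Import all_boot all_order all_algebra.
From mathcomp Require Import all_classical all_reals all_analysis.
From mathcomp Require Import zify ring lra.

Set Implicit Arguments.
Unset Strict Implicit.
Unset Printing Implicit Defensive.

Import Order.TTheory GRing.Theory Num.Theory.
Import numFieldNormedType.Exports.

Local Open Scope classical_set_scope.
Local Open Scope ring_scope.

(** * Independence of events generated by disjoint blocks of indices *)

Section block_independence.
Context (R : realType) (d : measure_display) (T : measurableType d).
Variable P : probability T R.

(** As functions of [A], both sides are finite measures: [P] restricted to [B], and [P] scaled by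
    [P B]. They agree on the pi-system [G], hence on the sigma-algebra it generates. *)
Lemma independent_g_sigma_algebra (G : set_system T) (B : set T) :
  setI_closed G -> G setT -> G `<=` measurable -> measurable B ->
  (forall A, G A -> P (A `&` B) = (P A * P B)%E) ->
  forall A, <<s G >> A -> P (A `&` B) = (P A * P B)%E.
Proof.
move=> GI GT Gm mB GB A GA.
have PB0 : 0 <= fine (P B) by exact: fine_ge0.
have PBE : (fine (P B))%:E = P B by rewrite fineK// fin_num_measure.
transitivity (mrestr P mB A); first by [].
transitivity (mscale (NngNum PB0) P A); last first.
  by rewrite /mscale/= PBE muleC.
apply: (@g_sigma_algebra_measure_unique _ _ _ G Gm (fun=> setT)) => //.
- by rewrite bigcup_const//; exists 0%N.
- move=> C GC; change (P (C `&` B) = ((fine (P B))%:E * P C)%E).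
  by rewrite GB// muleC PBE.
- move=> _; change (P (setT `&` B) < +oo)%E.
  by rewrite setTI -PBE ltry.
Qed.

Section blocks.
Context (I : eqType) (F : I -> set_system T).
Hypothesis F_measurable : forall i, F i `<=` measurable.
Hypothesis FT : forall i, F i setT.
Hypothesis FI : forall i, setI_closed (F i).
Hypothesis F_indep : mutually_independent P F.

(** The pi-system on which mutual independence can be read off directly; it generates the
    sigma-algebra of the block [J]. *)
Definition finite_cylinders (J : set I) : set_system T :=
  [set A | exists s E, [/\ uniq s, forall i, i \in s -> J i,
     forall i, i \in s -> F i (E i) & A = \bigcap_(i in [set` s]) E i]].

Lemma finite_cylindersT J : finite_cylinders J setT.
Proof. by exists [::], (fun=> setT); split => //; rewrite bigcapT. Qed.

Lemma finite_cylindersI J : setI_closed (finite_cylinders J).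
Proof.
move=> _ _ [s [E [us sJ sE ->]]] [s' [E' [us' s'J s'E ->]]].
(* Padding by [setT] outside the index list lets both cylinders be written over the union of the two
   lists. *)
pose X (s : seq I) (E : I -> set T) i := if i \in s then E i else setT.
have FX (s0 : seq I) E0 i : (forall i, i \in s0 -> F i (E0 i)) -> F i (X s0 E0 i).
  by move=> h; rewrite /X; case: ifPn => [/h//|_]; exact: FT.
exists (undup (s ++ s')), (fun i => X s E i `&` X s' E' i); split.
- exact: undup_uniq.
- by move=> i; rewrite mem_undup mem_cat => /orP[/sJ|/s'J].
- by move=> i _; apply: FI; exact: FX.
- apply/seteqP; split => [w [sw s'w] i /=|w sw].
    by move=> _; rewrite /X; split; case: ifPn => // ?; [apply: sw|apply: s'w].
  split=> i /= si; have /sw[] : [set` undup (s ++ s')] i.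
  + by rewrite /= mem_undup mem_cat si.
  + by rewrite /X si.
  + by rewrite /= mem_undup mem_cat si orbT.
  + by rewrite /X si.
Qed.

Lemma finite_cylinders_measurable J : finite_cylinders J `<=` measurable.
Proof.
move=> _ [s [E [_ _ sE ->]]]; apply: fin_bigcap_measurable => // i /sE.
exact: F_measurable.
Qed.

Lemma g_sigma_algebra_finite_cylinders J :
  <<s \bigcup_(i in J) F i >> `<=` <<s finite_cylinders J >>.
Proof.
apply: sub_sigma_algebra2 => A [i Ji FA].
exists [:: i], (fun=> A); split => //; try by move=> k; rewrite inE => /eqP ->.
by apply/seteqP; split=> [w Aw k _ //|w]; apply; rewrite /= inE.
Qed.

Lemma g_sigma_algebra_block_measurable J :
  <<s \bigcup_(i in J) F i >> `<=` measurable.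
Proof.
apply: smallest_sub; first exact: sigma_algebra_measurable.
by move=> A [i _ /F_measurable].
Qed.

(** The extension from pi-systems is applied twice, first to [A] with [B] fixed and then to [B] with
    a cylinder [A] fixed, which leaves a product formula for two cylinders. *)
Lemma block_independent (J K : set I) A B : J `&` K = set0 ->
  <<s \bigcup_(i in J) F i >> A -> <<s \bigcup_(i in K) F i >> B ->
  P (A `&` B) = (P A * P B)%E.
Proof.
move=> JK0 JA KB.
have mB := g_sigma_algebra_block_measurable KB.
apply: (independent_g_sigma_algebra (@finite_cylindersI J)
  (finite_cylindersT J) (@finite_cylinders_measurable J) mB _
  (g_sigma_algebra_finite_cylinders JA)) => {A JA} A JA.
have mA := finite_cylinders_measurable JA.
rewrite setIC muleC; apply: (independent_g_sigma_algebra (@finite_cylindersI K)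
  (finite_cylindersT K) (@finite_cylinders_measurable K) mA _
  (g_sigma_algebra_finite_cylinders KB)) => {B KB mB} B KB.
case: JA => s [E [us sJ sE ->]] {mA}; case: KB => s' [E' [us' s'K s'E ->]].
have dis i : i \in s' -> i \notin s.
  move=> s'i; apply/negP => si.
  by rewrite -[False]/(set0 i) -JK0; split; [exact: sJ|exact: s'K].
(* The index lists are disjoint, so the two families glue into one, and independence is used on [s],
   on [s'] and on their concatenation. *)
pose X i := if i \in s then E i else E' i.
have XE : \bigcap_(i in [set` s]) E i = \bigcap_(i in [set` s]) X i.
  by apply: eq_bigcapr => i /= si; rewrite /X si.
have XE' : \bigcap_(i in [set` s']) E' i = \bigcap_(i in [set` s']) X i.
  by apply: eq_bigcapr => i /= si; rewrite /X (negbTE (dis _ si)).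
have sX i : i \in s -> F i (X i) by move=> si; rewrite /X si; exact: sE.
have s'X i : i \in s' -> F i (X i).
  by move=> si; rewrite /X (negbTE (dis _ si)); exact: s'E.
rewrite XE XE' -bigcap_setU (F_indep us sX) (F_indep us' s'X) -big_cat/=.
rewrite -(@F_indep (s' ++ s)).
- by congr (P (bigcap _ _)); apply/seteqP; split => i /=;
    rewrite mem_cat => /orP.
- rewrite cat_uniq us us' andbT/=; apply/hasPn => i si.
  by apply/negP => /dis; rewrite si.
- by move=> i; rewrite mem_cat => /orP[/s'X|/sX].
Qed.

End blocks.
End block_independence.

(** * Finite partitions and closure properties of sigma-algebras *)

Lemma measure_partition (R : realType) (d : measure_display)
    (T : measurableType d) (P : probability T R) (A : finType) (Y : T -> A)
    (S : set T) :
  measurable S -> (forall a, measurable (Y @^-1` [set a])) ->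
  P S = (\sum_(a : A) P (S `&` Y @^-1` [set a]))%E.
Proof.
move=> mS mY.
have SE : S = \bigcup_(a in [set` enum A]) (S `&` Y @^-1` [set a]).
  apply/seteqP; split=> [w Sw|w [a _ []]//].
  by exists (Y w) => //=; rewrite mem_enum.
rewrite [in LHS]SE measure_fin_bigcup//.
- by rewrite -fsbig_seq ?enum_uniq// big_enum.
- exact: trivIset_preimage1_in.
- by move=> a _; exact: measurableI.
Qed.

Lemma g_sigma_algebra_preimage_measurable (d d' : measure_display)
    (T : measurableType d) (T' : measurableType d') (Y : T -> T') :
  measurable_fun setT Y -> g_sigma_algebra_preimage Y `<=` measurable.
Proof. by move=> mY _ [B mB <-]; exact: mY. Qed.

Lemma sigma_algebra_setI_closed (T : Type) (G : set_system T) :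
  sigma_algebra setT G -> setI_closed G.
Proof.
case=> G0 GC GU A B GA GB.
have GCC C : G C -> G (~` C) by rewrite -setTD; exact: GC.
rewrite -[A `&` B]setCK setCI; apply: (GCC); rewrite -bigcup2E.
by apply: GU => -[|[|i]] /=; [exact: (GCC)|exact: (GCC)|exact: G0].
Qed.

Lemma sigma_algebraT (T : Type) (G : set_system T) :
  sigma_algebra setT G -> G setT.
Proof. by case=> G0 GC _; rewrite -[setT]setD0; exact: GC. Qed.

Lemma g_sigma_algebra_cst (T : Type) (G : set_system T) (Q : Prop) :
  <<s G >> [set _ : T | Q].
Proof.
have [q|nq] := pselect Q.
  rewrite (_ : [set _ | Q] = setT); last by apply/seteqP; split.
  exact: sigma_algebraT.
rewrite (_ : [set _ | Q] = set0); last by apply/seteqP; split.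
exact: sigma_algebra0.
Qed.

(** * The protocol on frozen graphs, and conditioning on the graphs *)

Section protocol_law.
Context (R : realType) (n : nat) (dX : measure_display) (X : measurableType dX).
Context (Q : probability X R) (pr : protocol n X).

Lemma informed_eq (g g' : nat -> sgraph n) (y y' : nat -> X) k :
  (forall j, (j < k)%N -> g j = g' j) -> (forall j, (j < k)%N -> y j = y' j) ->
  informed pr g y k = informed pr g' y' k.
Proof.
elim: k => //= k IH gg' yy'; rewrite gg'// yy'// IH// => j jk.
  by apply: gg'; exact: ltnW.
by apply: yy'; exact: ltnW.
Qed.

Lemma informed_homo (g : nat -> sgraph n) (y : nat -> X) j k :
  (j <= k)%N -> informed pr g y j \subset informed pr g y k.
Proof.
elim: k => [|k IH]; first by rewrite leqn0 => /eqP ->.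
rewrite leq_eqVlt => /orP[/eqP ->//|/IH jk].
by apply: fintype.subset_trans jk _; exact: round_keeps.
Qed.

(* Running the protocol only at the rounds [sg 0 < sg 1 < ...] informs fewer
   vertices: the skipped rounds keep what is informed, and the others are
   monotone. *)
Lemma informed_subsequence (g : nat -> sgraph n) (y : nat -> X)
    (sg : nat -> nat) K N :
  {in gtn N &, {homo sg : i j / (i < j)%N}} ->
  (forall j, (j < N)%N -> (sg j < K)%N) ->
  informed pr (g \o sg) (y \o sg) N \subset informed pr g y K.
Proof.
move=> sgH; case: N sgH => [|N] sgH sgK; first exact: (informed_homo g y (leq0n _)).
suff H j : (j <= N)%N ->
    informed pr (g \o sg) (y \o sg) j.+1 \subset informed pr g y (sg j).+1.
  by apply: fintype.subset_trans (H N _) _ => //; exact/informed_homo/sgK.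
elim: j => [|j IH] jN /=.
  by apply: round_monotone; exact: (informed_homo g y (leq0n _)).
apply: round_monotone; apply: fintype.subset_trans (IH (ltnW jN)) _.
by apply: informed_homo; apply: sgH => //; rewrite !inE ltnS // ltnW.
Qed.

(** Forward recursion for the Markov chain of informed sets on frozen graphs. It refers to [Q] only,
    which makes runs on the two probability spaces comparable. *)
Fixpoint informed_law (g : nat -> sgraph n) (k : nat) (I : {set 'I_n}) : \bar R :=
  if k is k'.+1 then
    (\sum_(J : {set 'I_n}) informed_law g k' J *
       Q [set y | round pr (g k') y J = I])%E
  else if start pr == I then 1%E else 0%E.

Definition failure (g : nat -> sgraph n) (k : nat) : \bar R :=
  (\sum_(I : {set 'I_n} | I != [set: 'I_n]%SET) informed_law g k I)%E.

Context (d : measure_display) (T : measurableType d) (P : probability T R).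
Context (G : nat -> T -> sgraph n) (x : nat -> {RV P >-> X}).
Hypothesis G_rv : forall k, discrete_rv (G k).
Hypothesis Gx : protocol_choices Q G x.

Let F (o : option nat) : set_system T :=
  if o is Some k then g_sigma_algebra_preimage (x k)
  else <<s \bigcup_k sigma_discrete (G k) >>.

Let F_sigma_algebra o : sigma_algebra setT (F o).
Proof.
case: o => [k|] /=; last exact: smallest_sigma_algebra.
by apply: sigma_algebra_preimage; exact: sigma_algebra_measurable.
Qed.

Let F_measurable o : F o `<=` measurable.
Proof.
case: o => [k|] /=.
  by apply: g_sigma_algebra_preimage_measurable; exact: measurable_funPT.
apply: smallest_sub; first exact: sigma_algebra_measurable.
by move=> _ [k _ [B _ <-]]; rewrite setTI; exact: G_rv.
Qed.

Let block_indep (J K : set (option nat)) A B : J `&` K = set0 ->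
  <<s \bigcup_(i in J) F i >> A -> <<s \bigcup_(i in K) F i >> B ->
  P (A `&` B) = (P A * P B)%E.
Proof.
apply: block_independent F_measurable _ _ (Gx.2) J K A B => o.
  exact: sigma_algebraT.
exact: sigma_algebra_setI_closed.
Qed.

Lemma informed_g_sigma_algebra (g : nat -> sgraph n) (sg : nat -> nat) k I :
  <<s \bigcup_(o in [set Some (sg j) | j in `I_k]) F o >>
    [set w | informed pr g (fun j => x (sg j) w) k = I].
Proof.
elim: k I => [|k IH] I /=; first exact: g_sigma_algebra_cst.
set H := (X in <<s X >>).
rewrite (_ : [set w | _] = \bigcup_(J in [set: {set 'I_n}])
  ([set w | informed pr g (fun j => x (sg j) w) k = J] `&`
   x (sg k) @^-1` [set y | round pr (g k) y J = I])); last first.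
  apply/seteqP; split=> w /=; first by move=> wI; exists (informed pr g (fun j => x (sg j) w) k).
  by move=> [J _ [/= -> ->]].
(* The set is viewed in the measurable type carrying the generated sigma-algebra, so that the
   closure lemmas for measurable sets apply. *)
change (measurable ((\bigcup_(J in [set: {set 'I_n}])
  ([set w | informed pr g (fun j => x (sg j) w) k = J] `&`
   x (sg k) @^-1` [set y | round pr (g k) y J = I])) : set (g_sigma_algebraType H))).
apply: fin_bigcup_measurable; first exact: finite_finset.
move=> J _; apply: measurableI.
  apply: sub_sigma_algebra2 (IH J) => A [_ [j jk <-] FA].
  by exists (Some (sg j)) => //; exists j => //=; exact: ltnW.
apply: sub_gen_smallest; exists (Some (sg k)); first by exists k => /=.
by exists [set y | round pr (g k) y J = I]; [exact: round_measurable|rewrite setTI].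
Qed.

Lemma informed_measurable (g : nat -> sgraph n) (sg : nat -> nat) k I :
  measurable [set w | informed pr g (fun j => x (sg j) w) k = I].
Proof.
exact: (g_sigma_algebra_block_measurable F_measurable
  (@informed_g_sigma_algebra g sg k I)).
Qed.

(** By injectivity the choice of index [sg k] has not been used before round [k]. It is therefore
    independent of the current informed set, and its law is [Q] whatever its index. *)
Lemma informed_lawE (g : nat -> sgraph n) (sg : nat -> nat) k I :
  {in gtn k &, injective sg} ->
  P [set w | informed pr g (fun j => x (sg j) w) k = I] = informed_law g k I.
Proof.
elim: k I => [|k IH] I sgI /=.
  case: eqP => [->|nI].
    rewrite (_ : mkset _ = setT); first exact: probability_setT.
    by apply/seteqP; split.
  rewrite (_ : mkset _ = set0); first exact: measure0.
  by apply/seteqP; split.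
have mI := @informed_measurable g sg k.+1 I.
have mJ J := @informed_measurable g sg k J.
rewrite (measure_partition P mI mJ).
apply: eq_bigr => J _.
rewrite -IH; last by move=> i j; rewrite !inE => ik jk; apply: sgI; rewrite inE ltnW.
rewrite -(Gx.1 (sg k)); last exact: round_measurable.
rewrite -(@block_indep [set Some (sg j) | j in `I_k] [set Some (sg k)]).
- congr (P _); apply/seteqP; split=> w /= [].
    by move=> + wJ; rewrite /= wJ.
  by move=> wJ; rewrite /= wJ.
- apply/seteqP; split=> // o [[j /= jk <-] [/esym /sgI jk']].
  by have kj := jk' (ltnSn k) (ltnW jk); move: jk; rewrite -kj ltnn.
- exact: informed_g_sigma_algebra.
- apply: sub_gen_smallest; exists (Some (sg k)) => //=.
  by exists [set y | round pr (g k) y J = I]; [exact: round_measurable|rewrite setTI].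
Qed.

Lemma failureE (g : nat -> sgraph n) (sg : nat -> nat) k :
  {in gtn k &, injective sg} ->
  P [set w | informed pr g (fun j => x (sg j) w) k <> [set: 'I_n]%SET] =
  failure g k.
Proof.
move=> sgI; have mJ J := @informed_measurable g sg k J.
have mT : measurable [set w | informed pr g (fun j => x (sg j) w) k <> [set: 'I_n]%SET].
  by apply: measurableC; exact: mJ.
rewrite (measure_partition P mT mJ) /failure [RHS]big_mkcond/=.
apply: eq_bigr => J _; case: ifPn => [JT|/negPn/eqP ->].
  rewrite -(informed_lawE g J sgI); congr (P _).
  by apply/seteqP; split=> [w []//|w /= wJ]; split=> //; rewrite wJ; exact/eqP.
by rewrite (_ : _ `&` _ = set0) ?measure0//; apply/seteqP; split=> w [].
Qed.

Lemma failure_ge0 (g : nat -> sgraph n) k : (0 <= failure g k)%E.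
Proof. by rewrite -(@failureE g id)//; exact: measure_ge0. Qed.

Lemma failure_measurable (g : nat -> sgraph n) (sg : nat -> nat) k :
  measurable [set w | informed pr g (fun j => x (sg j) w) k <> [set: 'I_n]%SET].
Proof. by apply: measurableC; exact: informed_measurable. Qed.

Lemma failure_le1 (g : nat -> sgraph n) k : (failure g k <= 1)%E.
Proof.
by rewrite -(@failureE g id)//; exact/probability_le1/(@failure_measurable g id).
Qed.

Lemma failure_eq (g g' : nat -> sgraph n) k :
  (forall j, (j < k)%N -> g j = g' j) -> failure g k = failure g' k.
Proof.
move=> gg'; rewrite -(@failureE g id)// -(@failureE g' id)//; congr (P _).
by apply/funext => w; rewrite /=;
  rewrite (@informed_eq g g' (fun j => x j w) (fun j => x j w) k gg').
Qed.

(** Both failure probabilities are realised with the same choices: the short run takes those of the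
    rounds [sg j], which [failureE] allows. The inequality is then an inclusion of events. *)
Lemma failure_subsequence (g : nat -> sgraph n) (sg : nat -> nat) K N :
  {in gtn N &, {homo sg : i j / (i < j)%N}} ->
  (forall j, (j < N)%N -> (sg j < K)%N) ->
  (failure g K <= failure (g \o sg) N)%E.
Proof.
move=> sgH sgK; rewrite -(@failureE g id)// -(@failureE (g \o sg) sg); last first.
  move=> i j iN jN ij; case: (ltngtP i j) => // h.
    by have := sgH _ _ iN jN h; rewrite ij ltnn.
  by have := sgH _ _ jN iN h; rewrite ij ltnn.
apply: le_measure; rewrite ?inE.
- exact: (@failure_measurable g id).
- exact: (@failure_measurable _ sg).
move=> w /= wK wN; apply: wK; apply/eqP; rewrite -finset.subTset -wN.
exact: informed_subsequence (fun j => x j w) _ _ _ sgH sgK.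
Qed.

Let graph_prefix_g_sigma_algebra K (g : nat -> sgraph n) :
  F None [set w | forall j, (j < K)%N -> G j w = g j].
Proof.
rewrite (_ : mkset _ = \bigcap_(j in `I_K) (G j @^-1` [set g j])); last first.
  by apply/seteqP; split.
change (measurable ((\bigcap_(j in `I_K) (G j @^-1` [set g j])) :
  set (g_sigma_algebraType (\bigcup_k sigma_discrete (G k))))).
apply: fin_bigcap_measurable => // j _.
by apply: sub_gen_smallest; exists j => //; exists [set g j] => //; rewrite setTI.
Qed.

(** Once the first [K] graphs are prescribed, the run coincides with the one on [g], which depends
    on the choices alone and so is independent of the graphs. *)
Lemma graph_prefix_failure K (g : nat -> sgraph n) :
  P ([set w | forall j, (j < K)%N -> G j w = g j] `&`
     [set w | informed pr (fun j => G j w) (fun j => x j w) K <>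
              [set: 'I_n]%SET]) =
  (P [set w | forall j, (j < K)%N -> G j w = g j] * failure g K)%E.
Proof.
rewrite -(@failureE g id)// -(@block_indep [set None] [set Some j | j in `I_K]).
- congr (P _); apply/seteqP; split=> w /= [wg];
    by rewrite (@informed_eq (fun j => G j w) g (fun j => x j w) (fun j => x j w)).
- by apply/seteqP; split=> // i [-> []].
- by apply: sub_gen_smallest; exists None => //; exact: graph_prefix_g_sigma_algebra.
- set H := (X in <<s X >>).
  change (measurable (~` [set w | informed pr g (fun j => x j w) K = [set: 'I_n]%SET] :
    set (g_sigma_algebraType H))).
  apply: measurableC; exact: (@informed_g_sigma_algebra g id).
Qed.

(** Finite tuples are padded with empty graphs: this gives a finite type to sum over, and the first
    [K] rounds never see the padding. *)
Definition extend_graphs K (g : {ffun 'I_K -> sgraph n}) (j : nat) : sgraph n :=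
  if insub j is Some i then g i else [ffun=> false].

Lemma extend_graphsE K (g : {ffun 'I_K -> sgraph n}) (i : 'I_K) :
  extend_graphs g i = g i.
Proof. by rewrite /extend_graphs valK. Qed.

Let prefix K w : {ffun 'I_K -> sgraph n} := [ffun i : 'I_K => G i w].

Let prefixE K (g : {ffun 'I_K -> sgraph n}) : prefix K @^-1` [set g] =
  [set w | forall j, (j < K)%N -> G j w = extend_graphs g j].
Proof.
apply/seteqP; split=> w /= => [<- j jK|wg].
  by rewrite (extend_graphsE _ (Ordinal jK)) ffunE.
by apply/ffunP => i; rewrite ffunE wg// extend_graphsE.
Qed.

Let prefix_measurable K g : measurable (prefix K @^-1` [set g]).
Proof.
rewrite prefixE; apply: (@F_measurable None).
exact: graph_prefix_g_sigma_algebra.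
Qed.

Lemma failure_event_measurable K : measurable [set w |
  informed pr (fun j => G j w) (fun j => x j w) K <> [set: 'I_n]%SET].
Proof.
rewrite (_ : mkset _ = \bigcup_(g in [set: {ffun 'I_K -> sgraph n}])
    (prefix K @^-1` [set g] `&` [set w | informed pr (extend_graphs g)
       (fun j => x j w) K <> [set: 'I_n]%SET])).
  apply: fin_bigcup_measurable; first exact: finite_finset.
  move=> g _; apply: measurableI; first exact: prefix_measurable.
  exact: (@failure_measurable _ id).
have E w g : prefix K w = g -> informed pr (fun j => G j w) (fun j => x j w) K =
    informed pr (extend_graphs g) (fun j => x j w) K.
  move=> Kg; apply: informed_eq => // j jK.
  by have : (prefix K @^-1` [set g]) w by []; rewrite prefixE; exact.
apply/seteqP; split=> [w /= wT|w [g _ [/= /E -> //]]].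
by exists (prefix K w) => //; split=> //=; rewrite -E.
Qed.

Lemma informed_failure K :
  P [set w | informed pr (fun j => G j w) (fun j => x j w) K <> [set: 'I_n]%SET] =
  (\sum_(g : {ffun 'I_K -> sgraph n})
     P [set w | forall j, (j < K)%N -> G j w = extend_graphs g j] *
     failure (extend_graphs g) K)%E.
Proof.
rewrite (measure_partition P (failure_event_measurable K) (@prefix_measurable K)).
by apply: eq_bigr => g _; rewrite prefixE setIC graph_prefix_failure.
Qed.

End protocol_law.

(** * Deterministic properties of coalescence and of the iterated times *)

Section coalescence.
Context (R : realType) (A : finType) (f : R -> past A -> A).
Implicit Types (u : int -> R) (i j k : int) (a b : past A).

Lemma run_past_add u i a m1 m2 :
  run_past f u i a (m1 + m2) = run_past f u (i + m1%:Z) (run_past f u i a m1) m2.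
Proof.
elim: m2 => [|m2 IH] /=; first by rewrite addn0.
by rewrite addnS /= IH PoszD addrA.
Qed.

(** A run started at [j] is a run started at [i] from the past that it has produced by then. *)
Lemma coalesced_le u i j k : j <= i -> coalesced f u i k -> coalesced f u j k.
Proof.
move=> ji [ik fk]; split; first exact: le_trans ji ik.
have E a : iter_update f j k a u =
    iter_update f i k (run_past f u j a (absz (i - j))) u.
  rewrite /iter_update.
  have -> : absz (k - j + 1) = (absz (i - j)%R + absz (k - i + 1)%R)%N by lia.
  by rewrite run_past_add; congr (run_past _ _ _ _ _ _); lia.
by move=> a b; rewrite !E.
Qed.

Lemma is_coalescing_timeP u k i : is_coalescing_time f u k i <->
  coalesced f u i k /\ ~ coalesced f u (i + 1) k.
Proof.
split=> [[ik im]|[ik im]]; split=> //.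
  by move=> /im; lia.
move=> j jk; rewrite leNgt; apply/negP => ij; apply: im.
by apply: coalesced_le jk; lia.
Qed.

Lemma theta_SomeP u k i : theta f u k = Some i <-> is_coalescing_time f u k i.
Proof.
rewrite /theta; case: pselect => [h|h]; split.
- by move=> [<-]; exact: projT2 (cid h).
- case: (cid h) => j /= [jk jm] [ik im]; congr Some; apply/eqP.
  by rewrite eq_le jm// im.
- by [].
- by move=> ik; case: h; exists i.
Qed.

Definition cftp_step u k : option int := omap (fun s => s - 1) (theta f u k).

(** The starting time is a parameter, so that the first step can be split off and the remainder
    treated as a chain from the new time. *)
Definition cftp_chain u k (j : nat) : option int :=
  iter j (obind (cftp_step u)) (Some k).

Lemma cftp_chainS u k (j : nat) :
  cftp_chain u k j.+1 = obind (cftp_step u) (cftp_chain u k j).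
Proof. by []. Qed.

Lemma cftp_chainSl u k (j : nat) :
  cftp_chain u k j.+1 = obind (cftp_chain u ^~ j) (cftp_step u k).
Proof.
rewrite /cftp_chain iterSr /=; case: cftp_step => //=.
by elim: j => //= j ->.
Qed.

Lemma cftp_time_chain u (j : nat) : cftp_time f u j.+1 = cftp_chain u 0 j.
Proof.
case: j => // j; elim: j => // j IH; rewrite cftp_chainS -IH /=.
by case: (tau f u j).
Qed.

Lemma cftp_step_SomeP u k i : cftp_step u k = Some i <->
  coalesced f u (i + 1) k /\ ~ coalesced f u (i + 1 + 1) k.
Proof.
rewrite -is_coalescing_timeP -theta_SomeP /cftp_step.
case: theta => [j|] //=; split=> // -[]; first by move=> <-; rewrite subrK.
by move=> ->; rewrite addrK.
Qed.

Lemma cftp_step_lt u k i : cftp_step u k = Some i -> i < k.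
Proof. by move=> /cftp_step_SomeP[[]]; lia. Qed.

Lemma cftp_chain_prefix u k (j m : nat) t : (j <= m)%N ->
  cftp_chain u k m = Some t -> exists s, cftp_chain u k j = Some s.
Proof.
elim: m t => [|m IH] t; first by rewrite leqn0 => /eqP ->; exists t.
rewrite leq_eqVlt => /orP[/eqP ->|jm]; first by exists t.
by rewrite cftp_chainS; case E : cftp_chain => [s|]//= _; exact: IH jm E.
Qed.

Lemma cftp_chain_lt u k (j m : nat) s t : (j < m)%N ->
  cftp_chain u k j = Some s -> cftp_chain u k m = Some t -> t < s.
Proof.
elim: m t => // m IH t; rewrite ltnS leq_eqVlt cftp_chainS => /orP[/eqP ->|jm].
  by move=> -> /=; exact: cftp_step_lt.
move=> js; case E : cftp_chain => [s'|]//= /cftp_step_lt ts'.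
exact: lt_trans ts' (IH _ jm js E).
Qed.

Lemma run_past_solution u (e : int -> A) i m :
  (forall t, e (t + 1) = f (u (t + 1)) (fun j : nat => e (t - j%:Z))) ->
  run_past f u i (fun j : nat => e (i - 1 - j%:Z)) m =
  (fun j : nat => e (i + m%:Z - 1 - j%:Z)).
Proof.
move=> eH; elim: m => [|m IH]; first by rewrite /= addr0.
apply/funext => -[|j] /=; rewrite IH; last by congr e; lia.
have -> : i + m.+1%:Z - 1 - 0 = (i + m%:Z - 1) + 1 by lia.
by rewrite eH; congr (f (u _) _); lia.
Qed.

(** A solution [e] of the recursion is itself a run started from its own past, and after coalescence
    every past gives the same output. *)
Lemma coalesced_solution u (e : int -> A) a i k :
  (forall t, e (t + 1) = f (u (t + 1)) (fun j : nat => e (t - j%:Z))) ->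
  coalesced f u i k -> iter_update f i k a u = e k.
Proof.
move=> eH [ik /(_ a (fun j : nat => e (i - 1 - j%:Z))) ->].
by rewrite /iter_update run_past_solution//; congr e; lia.
Qed.

(** For fixed [a] this leaves only countably many possible pasts, whereas the type of all pasts is
    in general uncountable; measurability will rest on this. *)
Lemma run_past_seq u i a m :
  exists v : seq A, run_past f u i a m = foldr (@push_past A) a v.
Proof.
elim: m => [|m [v vE]]; first by exists [::].
by exists (f (u (i + m%:Z)) (run_past f u i a m) :: v); rewrite /= -vE.
Qed.

Lemma push_past_eq c a b :
  (push_past c a = b) <-> (c = b 0%N /\ a = (fun m => b m.+1)).
Proof.
by split=> [<-//|[-> ->]]; apply/funext => -[].
Qed.

End coalescence.

(** * Measurability and law of the successive couplings *)

Section coupling_law.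
Context (R : realType) (A : finType) (f : R -> past A -> A).
Context (d : measure_display) (T : measurableType d) (P : probability T R).
Context (p : past A -> A -> R) (U : int -> {RV P >-> R}) (eps : int -> T -> A).
Hypothesis eps_rv : forall t, discrete_rv (eps t).
Hypothesis eps_marginal :
  forall t g, P (eps t @^-1` [set g]) = P (eps 0 @^-1` [set g]).
Hypothesis eps_cftp : finite_cftp f p U eps.

Let F (t : int) : set_system T := g_sigma_algebra_preimage (U t).
Let u (w : T) : int -> R := fun t => U t w.

Let F_measurable t : F t `<=` measurable.
Proof. by apply: g_sigma_algebra_preimage_measurable; exact: measurable_funPT. Qed.

Let F_sigma_algebra t : sigma_algebra setT (F t).
Proof. by apply: sigma_algebra_preimage; exact: sigma_algebra_measurable. Qed.

Definition block_events (J : set int) : set_system T :=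
  <<s \bigcup_(t in J) F t >>.

Lemma block_events_le (J K : set int) :
  J `<=` K -> block_events J `<=` block_events K.
Proof.
by move=> JK; apply: sub_sigma_algebra2 => B [t Jt FB]; exists t => //; exact: JK.
Qed.

Lemma block_events_measurable J : block_events J `<=` measurable.
Proof. exact: g_sigma_algebra_block_measurable. Qed.

Lemma block_events_independent (J K : set int) B C : J `&` K = set0 ->
  block_events J B -> block_events K C -> P (B `&` C) = (P B * P C)%E.
Proof.
apply: block_independent F_measurable _ _ (cftp_independent eps_cftp) J K B C => t.
  exact: sigma_algebraT.
exact: sigma_algebra_setI_closed.
Qed.

Lemma block_events0 J : block_events J set0.
Proof. by rewrite /block_events; apply: sigma_algebra0. Qed.

Lemma block_eventsI J B C :
  block_events J B -> block_events J C -> block_events J (B `&` C).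
Proof. by apply: sigma_algebra_setI_closed; exact: smallest_sigma_algebra. Qed.

(** Prescribing the whole past [b] fixes the argument of the last update, so measurability of [f] in
    its real argument suffices. *)
Lemma run_past_block_events i (a b : past A) m :
  block_events [set t | i <= t < i + m%:Z] [set w | run_past f (u w) i a m = b].
Proof.
elim: m b => [|m IH] b /=; first exact: g_sigma_algebra_cst.
rewrite (_ : mkset _ =
  [set w | run_past f (u w) i a m = (fun j => b j.+1)] `&`
  U (i + m%:Z) @^-1` [set v | f v (fun j => b j.+1) = b 0%N]).
  apply: block_eventsI.
    by apply: block_events_le (IH _) => t /=; lia.
  apply: sub_gen_smallest; exists (i + m%:Z) => /=; first by lia.
  exists [set v | f v (fun j => b j.+1) = b 0%N]; last by rewrite setTI.
  exact: cftp_update_measurable eps_cftp _ _.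
apply/seteqP; split=> w /=; rewrite push_past_eq => -[].
  by move=> <- ->.
by move=> E; rewrite E => ->.
Qed.

Lemma iter_update_block_events i k (a : past A) (g : A) : i <= k ->
  block_events [set t | i <= t <= k] [set w | iter_update f i k a (u w) = g].
Proof.
move=> ik; rewrite /iter_update.
rewrite (_ : mkset _ = \bigcup_(v : seq A)
  (if foldr (@push_past A) a v 0%N == g then
   [set w | run_past f (u w) i a (absz (k - i + 1)%R) = foldr (@push_past A) a v]
   else set0)); last first.
  apply/seteqP; split=> [w /= wg|w [v _]] /=.
    have [v vE] := run_past_seq f (u w) i a (absz (k - i + 1)%R).
    by exists v => //; rewrite -vE wg eqxx.
  by case: eqP => // <- /= ->.
change (measurable (\bigcup_(v : seq A)
  (if foldr (@push_past A) a v 0%N == g then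
   [set w | run_past f (u w) i a (absz (k - i + 1)%R) = foldr (@push_past A) a v]
   else set0) : set (g_sigma_algebraType (\bigcup_(t in [set t | i <= t <= k]) F t)))).
apply: countable_bigcupT_measurable; first exact: countableP.
move=> v; case: ifPn => // _.
have sub : [set t | i <= t < i + (absz (k - i + 1)%R)%:Z] `<=` [set t | i <= t <= k].
  by move=> t /=; lia.
exact: (block_events_le sub (@run_past_block_events i a _ _)).
Qed.

(* [renewal a g k i]: one coupling from the past at time k, started from any
   past (here a), stops at i + 1 and outputs g. *)
Definition renewal (a : past A) (g : A) (k i : int) : set T :=
  [set w | cftp_step f (u w) k = Some i] `&`
  [set w | iter_update f (i + 1) k a (u w) = g].

(** The step equals [i] exactly when starting at [i + 1] gives coalescence at [k] and starting at
    [i + 2] does not; [cftp_stopping] handles both events. *)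
Lemma cftp_step_block_events k i :
  block_events [set t | i < t <= k] [set w | cftp_step f (u w) k = Some i].
Proof.
have [ik|ki] := ltP i k; last first.
  rewrite (_ : mkset _ = set0 :> set T); first exact: block_events0.
  by apply/seteqP; split=> // w /cftp_step_lt; lia.
rewrite (_ : mkset _ = [set w | coalesced f (u w) (i + 1) k] `&`
    ~` [set w | coalesced f (u w) (i + 1 + 1) k]); last first.
  by apply/seteqP; split=> w /=; rewrite cftp_step_SomeP.
apply: block_eventsI.
  apply: block_events_le (cftp_stopping eps_cftp _) => [t /=|]; lia.
have C B : block_events [set t | i < t <= k] B ->
    block_events [set t | i < t <= k] (~` B).
  by move=> h; rewrite -setTD; case: (smallest_sigma_algebra setT
    (\bigcup_(t in [set t | i < t <= k]) F t)) => _ /(_ _ h).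
apply: (C); have [ik'|ik'] := leP (i + 1 + 1) k.
  apply: block_events_le (cftp_stopping eps_cftp ik') => t /=; lia.
rewrite (_ : mkset _ = set0 :> set T); first exact: block_events0.
by apply/seteqP; split=> // w []; lia.
Qed.

Lemma renewal_block_events a g k i :
  block_events [set t | i < t <= k] (renewal a g k i).
Proof.
have [ik|ki] := ltP i k.
  apply: block_eventsI; first exact: cftp_step_block_events.
  by apply: block_events_le (iter_update_block_events _ _ _) => [t /=|]; lia.
rewrite (_ : renewal _ _ _ _ = set0); first exact: block_events0.
by apply/seteqP; split=> // w [/cftp_step_lt]; lia.
Qed.

(** The next time is enumerated as [k - l] to obtain a countable union; the term [l = 0] is empty,
    since a step goes strictly back. *)
Fixpoint renewals (a : past A) (gs : seq A) (k : int) : set T :=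
  if gs is g :: gs' then
    \bigcup_(l : nat) (renewal a g k (k - l%:Z) `&` renewals a gs' (k - l%:Z))
  else setT.

Lemma renewals_block_events a gs k :
  block_events [set t | t <= k] (renewals a gs k).
Proof.
elim: gs k => [|g gs IH] k /=.
  by apply: sigma_algebraT; exact: smallest_sigma_algebra.
apply: sigma_algebra_bigcup => l; apply: block_eventsI.
  by apply: block_events_le (@renewal_block_events _ _ _ _) => t /=; lia.
by apply: block_events_le (IH _) => t /=; lia.
Qed.

Let generated w := forall t : int,
  eps (t + 1) w = f (u w (t + 1)) (fun j : nat => eps (t - j%:Z) w).

(** The recursion for [eps] holds only almost surely, so inclusions that rely on it become
    inequalities of probabilities. *)
Lemma measure_ae_le (B C : set T) : measurable B -> measurable C ->
  (forall w, generated w -> B w -> C w) -> (P B <= P C)%E.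
Proof.
move=> mB mC BC; have [N [mN N0 gN]] := cftp_generated eps_cftp.
apply: (@le_trans _ _ (P (C `|` N))).
  apply: le_measure; rewrite ?inE//; first exact: measurableU.
  move=> w Bw; have [gw|ngw] := pselect (generated w); first by left; exact: BC.
  by right; apply: gN.
by rewrite (le_trans (measureU2 _ _ _))// [X in (_ + X)%E]N0 adde0.
Qed.

(* The renewals at k, then at the coalescence time of k, ... use disjoint blocks
   of the U's, so that their probabilities multiply. *)
Lemma renewals_le a gs k :
  (P (renewals a gs k) <= \prod_(g <- gs) P (eps 0 @^-1` [set g]))%E.
Proof.
elim: gs k => [|g gs IH] k /=; first by rewrite big_nil probability_setT.
set M := (\prod_(h <- gs) _)%E in IH.
have M0 : (0 <= M)%E by apply: (big_ind (fun y => 0 <= y)%E) => //; exact: mule_ge0.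
have mS gs' i : measurable (renewals a gs' i).
  exact: block_events_measurable (@renewals_block_events _ _ _).
have mR i : measurable (renewal a g k i).
  exact: block_events_measurable (@renewal_block_events _ _ _ _).
have finM : M \is a fin_num.
  rewrite /M; elim: (gs) => [|h hs IHh]; rewrite ?big_nil// big_cons fin_numM//.
  by rewrite fin_num_measure//; exact: eps_rv.
apply: (@le_trans _ _ (\sum_(0 <= l <oo) (P (renewal a g k (k - l%:Z)) * M))%E).
  apply: (@le_trans _ _ (\sum_(0 <= l <oo) P (renewal a g k (k - l%:Z) `&`
      renewals a gs (k - l%:Z)))%E).
    apply: measure_sigma_subadditive => //.
    - by move=> l; exact: measurableI.
    - by apply: bigcupT_measurable => l; exact: measurableI.
  (* The first coupling uses the [U_t] with [k - l < t <= k], the later ones only those with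
     [t <= k - l]. *)
  apply: lee_nneseries => // l _.
  rewrite (@block_events_independent [set t | k - l%:Z < t <= k]
    [set t | t <= k - l%:Z]).
  - by rewrite lee_wpmul2l.
  - by apply/seteqP; split=> // t /= []; lia.
  - exact: renewal_block_events.
  - exact: renewals_block_events.
under eq_eseriesr do rewrite muleC.
rewrite -(fineK finM) nneseriesZl// fineK// big_cons -/M muleC.
(* It remains to sum the probabilities of the first renewal over [l]. These events are disjoint
   because the step has a single value, and on their union [eps k] is almost surely [g]. *)
rewrite lee_wpmul2r// -(@eps_marginal k).
rewrite -measure_semi_bigcup//; last 2 first.
- apply: ltn_trivIset => i j ij; apply/seteqP; split=> // w [[wi _] [wj _]].
  by move: wi; rewrite /= wj => -[]; lia.
- exact: bigcupT_measurable.
apply: measure_ae_le; [exact: bigcupT_measurable|exact: eps_rv|].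
move=> w gw [l _ [/= /cftp_step_SomeP[c _] /= <-]].
by rewrite (coalesced_solution a (e := fun t => eps t w) gw c).
Qed.

(** Induction splitting off the first step: its coupling outputs [eps k], and the tail of [gs] is
    read along the chain from the time reached. *)
Lemma cftp_chain_renewals a gs k w t : generated w ->
  cftp_chain f (u w) k (size gs) = Some t ->
  (forall j s, (j < size gs)%N -> cftp_chain f (u w) k j = Some s ->
     eps s w = nth (eps k w) gs j) ->
  renewals a gs k w.
Proof.
elim: gs k => // g gs IH k gw; rewrite cftp_chainSl.
case E : cftp_step => [i|]//= it ij; have ik := cftp_step_lt E.
exists (absz (k - i)) => //; have -> : k - (absz (k - i))%:Z = i by lia.
split; first split=> //=.
  have /cftp_step_SomeP[c _] := E.
  rewrite (coalesced_solution a (e := fun t => eps t w) gw c).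
  exact: (ij 0%N k).
apply: IH gw it _ => j s jgs js.
have /(ij j.+1 s jgs) : cftp_chain f (u w) k j.+1 = Some s by rewrite cftp_chainSl E.
by rewrite /= => ->; exact: set_nth_default.
Qed.

Lemma cftp_chain_measurable (j : nat) k s :
  measurable [set w | cftp_chain f (u w) k j = Some s].
Proof.
elim: j s => [|j IH] s.
  apply: (@block_events_measurable set0).
  exact: (@g_sigma_algebra_cst _ _ (Some k = Some s)).
rewrite (_ : mkset _ = \bigcup_(i : int) ([set w | cftp_chain f (u w) k j = Some i] `&`
   [set w | cftp_step f (u w) i = Some s])).
  apply: countable_bigcupT_measurable; first exact: countableP.
  move=> i; apply: measurableI => //.
  exact: block_events_measurable (@cftp_step_block_events _ _).
apply/seteqP; split=> w.
  have -> : [set w | cftp_chain f (u w) k j.+1 = Some s] w =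
    (obind (cftp_step f (u w)) (cftp_chain f (u w) k j) = Some s) by [].
  by case E : cftp_chain => [i|]//= si; exists i.
move=> [i _ [wi wis]].
by change (obind (cftp_step f (u w)) (cftp_chain f (u w) k j) = Some s); rewrite wi.
Qed.

Lemma cftp_chain_eps_measurable (j : nat) k (g : A) :
  measurable [set w | eps (odflt 0 (cftp_chain f (u w) k j)) w = g].
Proof.
rewrite (_ : mkset _ = (~` (\bigcup_(s : int) [set w | cftp_chain f (u w) k j = Some s])
    `&` eps 0 @^-1` [set g]) `|` \bigcup_(s : int)
  ([set w | cftp_chain f (u w) k j = Some s] `&` eps s @^-1` [set g])).
  have mc : measurable (\bigcup_(s : int) [set w | cftp_chain f (u w) k j = Some s]).
    apply: countable_bigcupT_measurable; first exact: countableP.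
    by move=> s; exact: cftp_chain_measurable.
  apply: measurableU.
    by apply: measurableI; [exact: measurableC|exact: eps_rv].
  apply: countable_bigcupT_measurable; first exact: countableP.
  by move=> s; apply: measurableI; [exact: cftp_chain_measurable|exact: eps_rv].
apply/seteqP; split=> w; rewrite [X in X -> _]/=.
  case E : cftp_chain => [s|] /= wg; first by right; exists s.
  by left; split=> // -[s _]; rewrite /= E.
by move=> [[ns] wg|[s _ [/= -> //]]] /=; case E : cftp_chain => [s|]//; case: ns; exists s.
Qed.

End coupling_law.

(** * Comparison of the stationary sequence with independent graphs *)

Section comparison.
Context (R : realType) (n : nat) (dX : measure_display) (X : measurableType dX).
Context (Q : probability X R) (pr : protocol n X).
Context (d : measure_display) (T : measurableType d) (P : probability T R).
Context (eps : int -> T -> sgraph n) (x : nat -> {RV P >-> X}).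
Hypothesis eps_rv : forall t, discrete_rv (eps t).
Hypothesis eps_stationary : stationary P eps.
Hypothesis x_choices : protocol_choices Q (fun k : nat => eps k%:Z) x.
Context (d' : measure_display) (T' : measurableType d') (P' : probability T' R).
Context (G' : nat -> T' -> sgraph n) (x' : nat -> {RV P' >-> X}).
Hypothesis G'_rv : forall k, discrete_rv (G' k).
Hypothesis G'_marginal : forall k (g : sgraph n),
  P' (G' k @^-1` [set g]) = P (eps 0 @^-1` [set g]).
Hypothesis G'_independent :
  mutually_independent P' (fun k => sigma_discrete (G' k)).
Hypothesis x'_choices : protocol_choices Q G' x'.
Context (f : R -> past (sgraph n) -> sgraph n).
Context (p : past (sgraph n) -> sgraph n -> R) (U : int -> {RV P >-> R}).
Hypothesis eps_cftp : finite_cftp f p U eps.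

Let eps_rv_nat (k : nat) : discrete_rv (eps k%:Z) := eps_rv k%:Z.

Let chain w (j : nat) := cftp_chain f (fun t => U t w) 0 j.
Let fail := @failure R n dX X Q pr.

Definition chain_within (N L : nat) : set T :=
  [set w | exists2 t, chain w N = Some t & - L%:Z <= t].

Lemma chain_within_measurable N L : measurable (chain_within N L).
Proof.
rewrite (_ : chain_within N L = \bigcup_(t in [set t : int | - L%:Z <= t])
  [set w | chain w N = Some t]); last first.
  by apply/seteqP; split=> w [t]; exists t.
rewrite bigcup_mkcond; apply: countable_bigcupT_measurable; first exact: countableP.
by move=> t; case: ifPn => // _; exact: cftp_chain_measurable eps_cftp _ _ _.
Qed.

Let eps_marginal t g : P (eps t @^-1` [set g]) = P (eps 0 @^-1` [set g]).
Proof.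
have := eps_stationary [:: 0] (fun=> g) t.
rewrite (_ : mkset _ = eps t @^-1` [set g]); last first.
  apply/seteqP; split=> w /=; first by move=> /(_ 0); rewrite add0r; apply; rewrite inE.
  by move=> h s; rewrite inE => /eqP ->; rewrite add0r.
move=> ->; congr (P _); apply/seteqP; split=> w /=; first by apply; rewrite inE.
by move=> h s; rewrite inE => /eqP ->.
Qed.

Let window (L : nat) (g : {ffun 'I_L.+1 -> sgraph n}) : set T :=
  [set w | forall j : nat, (j < L.+1)%N -> eps (j%:Z - L%:Z) w = extend_graphs g j].

Let window_stationary L g :
  P [set w | forall j : nat, (j < L.+1)%N -> eps j%:Z w = extend_graphs g j] =
  P (@window L g).
Proof.
set s := [seq j%:Z | j <- iota 0 L.+1].
have := eps_stationary s (fun t => extend_graphs g (absz t)) (- L%:Z).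
have H (e : int -> T -> sgraph n) :
    [set w | forall t, t \in s -> e t w = extend_graphs g (absz t)] =
    [set w | forall j : nat, (j < L.+1)%N -> e j%:Z w = extend_graphs g j].
  apply/seteqP; split=> w wg.
    move=> j jL; have -> // := wg j%:Z.
    by apply/mapP; exists j => //; rewrite mem_iota.
  by move=> _ /mapP[j + ->]; rewrite mem_iota => /wg.
by rewrite (H eps) (H (fun t => eps (t - L%:Z))) => <-.
Qed.

Let window_fun L w : {ffun 'I_L.+1 -> sgraph n} :=
  [ffun i : 'I_L.+1 => eps (i%:Z - L%:Z) w].

Let windowE L g : window_fun L @^-1` [set g] = @window L g.
Proof.
apply/seteqP; split=> w /= => [<- j jK|wg].
  by rewrite (extend_graphsE _ (Ordinal jK)) ffunE.
by apply/ffunP => i; rewrite ffunE wg// extend_graphsE.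
Qed.

Let window_measurable L g : measurable (window_fun L @^-1` [set g]).
Proof.
rewrite windowE (_ : window g =
  \bigcap_(j in `I_L.+1) (eps (j%:Z - L%:Z) @^-1` [set extend_graphs g j])).
  by apply: fin_bigcap_measurable => // j _; exact: eps_rv.
by apply/seteqP; split.
Qed.

Let sample N w : {ffun 'I_N -> sgraph n} :=
  [ffun j : 'I_N => eps (odflt 0 (chain w j)) w].

Let sample_measurable N h : measurable (sample N @^-1` [set h]).
Proof.
rewrite (_ : _ @^-1` _ = \bigcap_(j in [set: 'I_N])
    [set w | eps (odflt 0 (chain w j)) w = h j]).
  apply: fin_bigcap_measurable; first exact: finite_finset.
  by move=> j _; exact: (cftp_chain_eps_measurable eps_rv eps_cftp).
apply/seteqP; split=> w /=; first by move=> <- j _; rewrite /= ffunE.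
by move=> wh; apply/ffunP => j; rewrite ffunE wh.
Qed.

Let sample_le N L h :
  (P (chain_within N L `&` sample N @^-1` [set h]) <=
   \prod_(j < N) P (eps 0%Z @^-1` [set h j]))%E.
Proof.
(* Outputs after coalescence do not depend on the past, so any fixed one will do. *)
pose a0 : past (sgraph n) := fun=> [ffun=> false].
have := renewals_le eps_rv eps_marginal eps_cftp a0 (mkseq (extend_graphs h) N) 0.
rewrite /mkseq big_map -[N in iota _ N]subn0 big_mkord.
rewrite (eq_bigr (fun j : 'I_N => P (eps 0%Z @^-1` [set h j]))); last first.
  by move=> j _; rewrite extend_graphsE.
apply: le_trans; apply: (measure_ae_le eps_cftp).
- by apply: measurableI; [exact: chain_within_measurable|exact: sample_measurable].
- apply: (block_events_measurable (U := U)).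
  exact: (renewals_block_events eps_cftp).
move=> w gw [[t wt _] /= wh]; rewrite subn0.
apply: (cftp_chain_renewals _ gw (t := t)); rewrite size_map size_iota//.
move=> j s jN js; rewrite (nth_map 0%N) ?size_iota// nth_iota// add0n.
rewrite (extend_graphsE h (Ordinal jN)) -wh ffunE /= /chain.
by rewrite js.
Qed.

(** The chain runs backwards in time and the protocol forwards. *)
Let reverse N (h : {ffun 'I_N -> sgraph n}) : {ffun 'I_N -> sgraph n} :=
  [ffun j => h (rev_ord j)].

Let reverseK N : involutive (@reverse N).
Proof. by move=> h; apply/ffunP => j; rewrite !ffunE rev_ordK. Qed.

Let fail_window N L (g : {ffun 'I_L.+1 -> sgraph n}) h w :
  window g w -> chain_within N L w -> sample N w = h ->
  (fail (extend_graphs g) L.+1 <= fail (extend_graphs (reverse h)) N)%E.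
Proof.
move=> wg [t wt Lt] wh.
pose s j := odflt 0 (chain w j).
have sE j : (j < N)%N -> chain w j = Some (s j).
  by move=> jN; have [i iE] := cftp_chain_prefix (ltnW jN) wt; rewrite /s /chain iE.
have s_ge j : (j < N)%N -> - L%:Z <= s j.
  move=> jN; apply: (le_trans Lt); apply: ltW.
  exact: (cftp_chain_lt jN (sE _ jN) wt).
have s_le j : (j < N)%N -> s j <= 0.
  case: j => // j jN; apply: ltW.
  exact: (cftp_chain_lt (ltn0Sn j) (erefl (chain w 0)) (sE _ jN)).
have s_lt i j : (i < j)%N -> (j < N)%N -> s j < s i.
  move=> ij jN; have iN := ltn_trans ij jN.
  exact: (cftp_chain_lt ij (sE _ iN) (sE _ jN)).
(* Time [t] is round [L + t] of the window; the chain times are taken from the oldest, of index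
   [N - 1], to the most recent, of index [0]. *)
pose sg (j : nat) := absz (L%:Z + s (N - j.+1)%N).
have NjN j : (j < N)%N -> (N - j.+1 < N)%N by lia.
have sgL j : (j < N)%N -> (sg j < L.+1)%N.
  by move=> /NjN jN; have := s_ge _ jN; have := s_le _ jN; rewrite /sg; lia.
have := @failure_subsequence R n dX X Q pr d T P _ x eps_rv_nat x_choices
  (extend_graphs g) sg L.+1 N.
move=> /(_ _ sgL) H; apply: (le_trans (H _)).
  move=> i j iN jN ij; have ji : (N - j.+1 < N - i.+1)%N by move: iN jN; rewrite !inE; lia.
  have := s_lt _ _ ji (NjN _ iN); have := s_ge _ (NjN _ iN).
  by have := s_ge _ (NjN _ jN); rewrite /sg; lia.
rewrite (@failure_eq R n dX X Q pr d T P _ x eps_rv_nat x_choices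
  _ (extend_graphs (reverse h)))// => j jN /=.
rewrite (extend_graphsE _ (Ordinal jN)) ffunE -wh ffunE /= -wg ?sgL//.
congr (eps _ w); rewrite -/(s _) /sg; have := s_ge _ (NjN _ jN).
by move: (s _) => z; lia.
Qed.

Let prefix'_prod N (h : {ffun 'I_N -> sgraph n}) :
  P' [set w | forall j, (j < N)%N -> G' j w = extend_graphs h j] =
  (\prod_(j < N) P (eps 0%Z @^-1` [set h j]))%E.
Proof.
have := @G'_independent (iota 0 N) (fun j => G' j @^-1` [set extend_graphs h j])
  (iota_uniq _ _).
rewrite (_ : bigcap _ _ = [set w | forall j, (j < N)%N -> G' j w = extend_graphs h j]).
  move=> ->; last by move=> j _; eexists; last exact: setTI.
  rewrite -[N in iota _ N]subn0 big_mkord; apply: eq_bigr => j _.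
  by rewrite G'_marginal extend_graphsE.
apply/seteqP; split=> w /= wh j /=.
  by move=> jN; apply: wh; rewrite /= mem_iota.
by rewrite /= mem_iota; exact: wh.
Qed.

Lemma stationary_failure_le N L :
  (P [set w | informed pr (fun j => eps j%:Z w) (fun j => x j w) L.+1 <>
              [set: 'I_n]%SET] <=
   P (~` chain_within N L) +
   P' [set w | informed pr (fun j => G' j w) (fun j => x' j w) N <>
               [set: 'I_n]%SET])%E.
Proof.
have fail0 g k : (0 <= fail g k)%E := failure_ge0 pr eps_rv_nat x_choices g k.
have mE := chain_within_measurable N L.
rewrite (informed_failure pr eps_rv_nat x_choices).
under eq_bigr do rewrite window_stationary -windowE.
rewrite (informed_failure pr G'_rv x'_choices).
under [X in (_ <= _ + X)%E]eq_bigr do rewrite prefix'_prod.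
(* The independent graphs are summed over reversed tuples, to match [fail_window]. *)
rewrite (reindex_inj (inv_inj (@reverseK N)))/=.
have split_window g : P (window_fun L @^-1` [set g]) =
    (P (~` chain_within N L `&` window_fun L @^-1` [set g]) +
     P (chain_within N L `&` window_fun L @^-1` [set g]))%E.
  rewrite -measureU//.
  - by rewrite -setIUl setUC setUv setTI.
  - by apply: measurableI => //; exact: measurableC.
  - exact: measurableI.
  - by rewrite setIACA setICl set0I.
under eq_bigr do rewrite split_window ge0_muleDl//.
(* Off [chain_within N L] the failure probability is bounded by [1]; on it, the window is compared
   with the sample. *)
rewrite big_split/=; apply: leeD.
  rewrite (measure_partition P (measurableC mE) (@window_measurable L)).
  apply: lee_sum => g _; rewrite -[leRHS]mule1 lee_wpmul2l//.
  exact: failure_le1 eps_rv_nat x_choices _ _.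
apply: (@le_trans _ _ (\sum_(g : {ffun 'I_L.+1 -> sgraph n})
  \sum_(h : {ffun 'I_N -> sgraph n})
   P ((chain_within N L `&` sample N @^-1` [set h]) `&` window_fun L @^-1` [set g]) *
   fail (extend_graphs (reverse h)) N)%E).
  apply: lee_sum => g _.
  rewrite (measure_partition P (measurableI _ _ mE (window_measurable g))
    (@sample_measurable N)).
  rewrite ge0_sume_distrl//; apply: lee_sum => h _; rewrite setIAC.
  set S := _ `&` sample N @^-1` [set h].
  (* Either the event is empty, or one of its points gives the bound of [fail_window], which
     involves only [g] and [h]. *)
  have [->|/set0P[w [[wE wg] /= wh]]] := eqVneq S set0.
    by rewrite measure0 !mul0e.
  rewrite lee_wpmul2l//; apply: (@fail_window N L g h w) => //.
  by rewrite -windowE.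
rewrite exchange_big/=; apply: lee_sum => h _.
rewrite -ge0_sume_distrl//.
rewrite -(measure_partition P (measurableI _ _ mE (sample_measurable h))
  (@window_measurable L)).
rewrite lee_wpmul2r//; apply: le_trans (sample_le L h) _.
rewrite (reindex_inj rev_ord_inj)/= le_eqVlt; apply/orP; left; apply/eqP.
by apply: eq_bigr => j _; rewrite ffunE.
Qed.

End comparison.

(** * From real bounds to numbers of rounds *)

Section completion.
Context (R : realType) (n : nat) (dX : measure_display) (X : measurableType dX).
Context (pr : protocol n X) (G : nat -> sgraph n) (x : nat -> X).

Lemma completion_time_le k : informed pr G x k = [set: 'I_n]%SET ->
  (completion_time R pr G x <= k%:R%:E)%E.
Proof. by move=> kT; apply: ge_ereal_inf; exists k%:R%:E => //; exists k. Qed.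

Lemma completion_time_ge k : informed pr G x k <> [set: 'I_n]%SET ->
  (k.+1%:R%:E <= completion_time R pr G x)%E.
Proof.
move=> kT; apply: le_ereal_inf_tmp => _ [j /= jT <-].
rewrite lee_fin ler_nat ltnNge; apply/negP => jk; apply: kT.
by apply/eqP; rewrite -finset.subTset -jT; exact: informed_homo.
Qed.

(** The completion time is a natural number or infinite, so only the integer part of [c] counts. *)
Lemma completion_time_gtP (c : R) : 0 <= c ->
  (c%:E < completion_time R pr G x)%E <->
  informed pr G x (Num.truncn c) <> [set: 'I_n]%SET.
Proof.
move=> c0; have /andP[cl cu] := truncn_itv c0; split.
  move=> + /completion_time_le h; rewrite ltNge => /negP; apply.
  by apply: le_trans h _; rewrite lee_fin.
by move=> /completion_time_ge; apply: lt_le_trans; rewrite lte_fin.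
Qed.

End completion.

Lemma cftp_depth_chain (R : realType) (A : finType) (f : R -> past A -> A)
    (u : int -> R) (N : nat) (c : R) : 0 <= c ->
  (c%:E < cftp_depth f u N.+1)%E <->
  ~ exists2 t, cftp_chain f u 0 N = Some t & - (absz (Num.floor c))%:Z <= t.
Proof.
move=> c0; have f0 : 0 <= Num.floor c by rewrite floor_ge0.
rewrite /cftp_depth cftp_time_chain; case: cftp_chain => [t|]; last first.
  by rewrite ltry; split=> // _ [].
rewrite lte_fin ltNge; have <- : (- t <= Num.floor c) = (- t%:~R <= c).
  by rewrite floor_ge_int rmorphN.
split=> [/negP h [_ [<-] ht]|h]; first by apply: h; lia.
by apply/negP => ht; apply: h; exists t => //; lia.
Qed.

(** With [m] the minimum of [a] and [b], each term is at most [y] to the power [- m]. Half of the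
    exponent is given up to absorb the factor 2. *)
Lemma powR_sum_le (R : realType) (y a b : R) :
  1 <= y -> 2 <= y `^ (Num.min a b / 2) ->
  y `^ (- a) + y `^ (- b) <= y `^ (- (Num.min a b / 2)).
Proof.
set m := Num.min a b => y1 y2; have y0 : 0 < y by exact: lt_le_trans y1.
have le_m e : m <= e -> y `^ (- e) <= y `^ (- (m / 2)) * 2^-1.
  move=> me; apply: (@le_trans _ _ (y `^ (- m))).
    by apply: ler_powR => //; rewrite lerN2.
  rewrite [in X in X <= _](_ : - m = - (m / 2) + - (m / 2)); last by field.
  rewrite powRD; last by rewrite (gt_eqF y0) implybT.
  rewrite ler_wpM2l ?powR_ge0// powRN lef_pV2 ?posrE//.
  exact: lt_le_trans y2.
have la : y `^ (- a) <= y `^ (- (m / 2)) * 2^-1 by apply: le_m; rewrite ge_min lexx.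
have lb : y `^ (- b) <= y `^ (- (m / 2)) * 2^-1.
  by apply: le_m; rewrite ge_min lexx orbT.
lra.
Qed.

(** * Choice of constants and conclusion *)

Theorem theorem2 (R : realType) (r : nat -> R)
  (* the protocol on n vertices, its per-round choices having law Q n *)
  (dX : nat -> measure_display) (X : forall n, measurableType (dX n))
  (Q : forall n, probability (X n) R)
  (pr : forall n, protocol n (X n))
  (* the stationary sequence of graphs, and the choices made on it *)
  (d : nat -> measure_display) (T : forall n, measurableType (d n))
  (P : forall n, probability (T n) R)
  (eps : forall n, int -> T n -> sgraph n)
  (x : forall n, nat -> {RV (P n) >-> (X n)})
  (eps_rv : forall n t, discrete_rv (eps n t))
  (eps_stationary : forall n, stationary (P n) (eps n))
  (x_choices : forall n,
     protocol_choices (Q n) (fun k : nat => eps n k%:Z) (x n))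
  (* independent graphs with the stationary marginal, and the choices *)
  (d' : nat -> measure_display) (T' : forall n, measurableType (d' n))
  (P' : forall n, probability (T' n) R)
  (G' : forall n, nat -> T' n -> sgraph n)
  (x' : forall n, nat -> {RV (P' n) >-> (X n)})
  (G'_rv : forall n k, discrete_rv (G' n k))
  (G'_marginal : forall n k (g : sgraph n),
     P' n (G' n k @^-1` [set g]) = P n (eps n 0 @^-1` [set g]))
  (G'_independent : forall n,
     mutually_independent (P' n) (fun k => sigma_discrete (G' n k)))
  (x'_choices : forall n, protocol_choices (Q n) (G' n) (x' n))
  (G'_completion :
     bigO_whp P' (fun n w =>
       completion_time R (pr n) (fun k => G' n k w) (fun k => x' n k w)) r)
  (* the coupling from the past *)
  (f : forall n, R -> past (sgraph n) -> sgraph n)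
  (p : forall n, past (sgraph n) -> sgraph n -> R)
  (U : forall n, int -> {RV (P n) >-> R})
  (eps_cftp : forall n, finite_cftp (f n) (p n) (U n) (eps n)) :
  exists C0 D0 : R, forall C D lambda : R,
    C0 <= C -> D0 <= D -> 0 < lambda ->
    (\forall n \near \oo,
       (P n [set w | (D * r n)%:E <
                     cftp_depth (f n) (fun t => U n t w)
                       (absz (Num.ceil (C * r n)))]
        <= (n%:R `^ (- lambda))%:E)%E) ->
    bigO_whp P (fun n w =>
      completion_time R (pr n) (fun k => eps n k%:Z w) (fun k => x n k w)) r.
Proof.
case: G'_completion => C' [c' [C'0 c'0 G'c]].
(* The factor 2 pays for the index shift: with [N + 1] the ceiling of [C * r n] and [C' * r n >= 1],
   it gives [N >= C' * r n]. *)
exists (2 * C'), 0 => C D lambda hC hD l0 depth.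
pose m := Num.min c' lambda.
have m0 : 0 < m by rewrite lt_min c'0 l0.
(* The window needs [L + 1] rounds, where [L] is the floor of [D * r n]; the extra round is paid for
   by [C' * r n >= 1]. *)
exists (D + C'), (m / 2); split; [by rewrite ltr_wpDl|by rewrite divr_gt0|].
near=> n.
have n2 : (2 <= n)%N by near: n; exact: nbhs_infty_ge.
have n1 : 1 <= n%:R :> R by rewrite (ler_nat _ 1) ltnW.
have nm : 2 <= n%:R `^ (m / 2) :> R.
  rewrite [leLHS](_ : 2 = (2 `^ (2 / m)) `^ (m / 2) :> R); last first.
    by rewrite -powRrM mulrA divfK ?gt_eqF// divff// powRr1.
  apply: ge0_ler_powR; rewrite ?nnegrE ?powR_ge0 ?divr_ge0 ?ltW// ?ltr0n//.
    exact: ltn_trans n2.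
  by near: n; exact: nbhs_infty_gtr.
have G'cn : (P' n [set w | (C' * r n)%:E <
  completion_time R (pr n) (G' n ^~ w) (fun k => x' n k w)] <=
  (n%:R `^ (- c'))%:E)%E by near: n.
have depthn : (P n [set w | (D * r n)%:E < cftp_depth (f n) (fun t => U n t w)
   (absz (Num.ceil (C * r n)))] <= (n%:R `^ (- lambda))%:E)%E by near: n.
have start_n G y : informed (pr n) G y 0 <> [set: 'I_n]%SET.
  move=> /= sT; have := start_single (pr n) (ltnW n2).
  by rewrite sT cardsT card_ord => n1'; move: n2; rewrite n1'.
(* Otherwise the completion time, which is at least [1] since [n >= 2], would surely exceed
   [C' * r n], against a bound smaller than [1]. *)
have r1 : 1 <= C' * r n.
  rewrite leNgt; apply/negP => r1; move: G'cn.
  rewrite (_ : mkset _ = setT) ?probability_setT; last first.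
    apply/seteqP; split=> // w _ /=; apply: lt_le_trans (completion_time_ge R (start_n _ _)).
    by rewrite lte_fin.
  rewrite lee_fin leNgt => /negP; apply.
  rewrite powRN invf_lt1 ?powR_gt0 ?(lt_le_trans ltr01)//.
  apply: (@lt_le_trans _ _ (n%:R `^ (m / 2))); first by rewrite (lt_le_trans _ nm)// ltr1n.
  apply: ler_powR => //; apply: (@le_trans _ _ m).
    by move: (m) m0 => z; lra.
  by rewrite ge_min lexx.
have rn0 : 0 < r n by rewrite -(pmulr_rgt0 _ C'0) (lt_le_trans ltr01).
have Dr0 : 0 <= D * r n by rewrite mulr_ge0// ltW.
have Cr : 2 * (C' * r n) <= C * r n by rewrite mulrA ler_wpM2r// ltW.
(* The hypothesis concerns the time of index [N + 1], which is entry [N] of the chain counted from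
   [0]. *)
pose N := (absz (Num.ceil (C * r n))).-1.
have ceil1 : 1 < Num.ceil (C * r n).
  by rewrite ceil_gt_int; lra.
have NE : absz (Num.ceil (C * r n)) = N.+1.
  by rewrite prednK// absz_gt0 gt_eqF// (lt_trans ltr01 ceil1).
have N_ge : C' * r n <= N%:R.
  have := ceil_ge (C * r n).
  have -> : Num.ceil (C * r n) = N.+1%:Z.
    by rewrite -NE gez0_abs// ltW// (lt_trans ltr01 ceil1).
  by rewrite -pmulrn -natr1; lra.
pose L := absz (Num.floor (D * r n)).
have L_le : L.+1%:R <= (D + C') * r n.
  rewrite mulrDl -natr1 lerD// pmulrn /L gez0_abs ?floor_ge0//.
  exact: floor_le.
have C''r0 : 0 <= (D + C') * r n by exact: le_trans L_le.
rewrite (_ : mkset _ = [set w | informed (pr n) (fun k => eps n k%:Z w)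
    (fun k => x n k w) (Num.truncn ((D + C') * r n)) <> [set: 'I_n]%SET]); last first.
  by apply/seteqP; split=> w /=; rewrite completion_time_gtP.
have mono (G : nat -> sgraph n) y j k : (j <= k)%N ->
    informed (pr n) G y k <> [set: 'I_n]%SET -> informed (pr n) G y j <> [set: 'I_n]%SET.
  move=> jk kT jT; apply: kT; apply/eqP; rewrite -finset.subTset -jT.
  exact: informed_homo.
apply: (@le_trans _ _ (P n [set w | informed (pr n) (fun k => eps n k%:Z w)
    (fun k => x n k w) L.+1 <> [set: 'I_n]%SET])).
  apply: le_measure; rewrite ?inE.
  - exact: (failure_event_measurable (pr n) (x n) (fun k : nat => eps_rv n k%:Z)).
  - exact: (failure_event_measurable (pr n) (x n) (fun k : nat => eps_rv n k%:Z)).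
  by move=> w; apply: mono; rewrite truncn_ge_nat.
apply: le_trans (stationary_failure_le (pr n) (eps_rv n) (eps_stationary n)
  (x_choices n) (G'_rv n) (@G'_marginal n) (G'_independent n) (x'_choices n)
  (eps_cftp n) N L) _.
apply: (@le_trans _ _ ((n%:R `^ (- lambda))%:E + (n%:R `^ (- c'))%:E)%E); last first.
  by rewrite -EFinD lee_fin addrC; exact: powR_sum_le.
apply: leeD.
  apply: le_trans depthn; rewrite NE le_eqVlt; apply/orP; left; apply/eqP.
  congr (P n _); apply/seteqP; split=> w /=; by rewrite cftp_depth_chain.
apply: le_trans G'cn.
rewrite [X in (_ <= P' n X)%E](_ : _ = [set w | informed (pr n) (G' n ^~ w)
    (fun k => x' n k w) (Num.truncn (C' * r n)) <> [set: 'I_n]%SET]); last first.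
  by apply/seteqP; split=> w /=; rewrite completion_time_gtP// (le_trans ler01).
apply: le_measure; rewrite ?inE.
- exact: (failure_event_measurable (pr n) (x' n) (G'_rv n)).
- exact: (failure_event_measurable (pr n) (x' n) (G'_rv n)).
move=> w; apply: mono; rewrite -ltnS truncn_lt_nat ?(le_trans ler01)//.
by rewrite (le_lt_trans N_ge)// ltr_nat.
Unshelve. all: by end_near.
Qed.
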